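(* The Baxter monoid satisfies the identity $xyxyxy = xyyxxy$; that is, for all $x,y \in \mathcal{A}^*$, $xyxyxy \equiv_{\mathrm{baxt}} xyyxxy$.
   Context: $\mathcal{A} = \{1,2,3,\ldots\}$ with the usual order; $\mathcal{A}^*$ the free monoid over $\mathcal{A}$. $\mathrm{rtree}(a_1\cdots a_k)$ is the right strict binary search tree obtained from the empty tree by inserting $a_k,\ldots,a_1$ in turn, where inserting $a$ creates a node at an empty position and otherwise recurses into the left subtree if $a \le$ root label, into the right subtree otherwise. $\mathrm{ltree}(a_1\cdots a_k)$ is the left strict binary search tree obtained from the empty tree by inserting $a_1,\ldots,a_k$ in turn, where inserting $a$ recurses into the right subtree if $a \ge$ root label and into the left subtree otherwise. The Baxter congruence: $u \equiv_{\mathrm{baxt}} v$ iff $\mathrm{ltree}(u)=\mathrm{ltree}(v)$ and $\mathrm{rtree}(u)=\mathrm{rtree}(v)$; the Baxter monoid is $\mathcal{A}^*/{\equiv_{\mathrm{baxt}}}$. *)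

(* Defs.v *)
From mathcomp Require Import all_boot.

Set Implicit Arguments.
Unset Strict Implicit.
Unset Printing Implicit Defensive.

Definition letter := {n : nat | 0 < n}.

Definition word := seq letter.

Inductive btree : Type :=
| Empty
| Node (l : btree) (a : letter) (r : btree).

Fixpoint rinsert (a : letter) (t : btree) : btree :=
  match t with
  | Empty => Node Empty a Empty
  | Node l b r =>
      if val a <= val b then Node (rinsert a l) b r else Node l b (rinsert a r)
  end.

Fixpoint linsert (a : letter) (t : btree) : btree :=
  match t with
  | Empty => Node Empty a Empty
  | Node l b r =>
      if val b <= val a then Node l b (linsert a r) else Node (linsert a l) b r
  end.

(* [foldr] inserts the letters of [w] from last to first. *)
Definition rtree (w : word) : btree := foldr rinsert Empty w.

(* [foldl] inserts the letters of [w] from first to last. *)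
Definition ltree (w : word) : btree := foldl (fun t a => linsert a t) Empty w.

Definition baxt_equiv (u v : word) : Prop :=
  ltree u = ltree v /\ rtree u = rtree v.

(* Main.v *)
Require Import Defs.
From mathcomp Require Import all_boot.

(** Both sides of the identity are of the form [xy m xy], with middle factors
    that are permutations of each other. Once a binary search tree contains the
    letters [a] and [b], insertions of [a] and [b] commute: if [a < b], the
    searches part at a node labelled [a] (for [rtree]) or [b] (for [ltree]), at
    the latest. Hence, above a factor [xy] inserted first, only the multiset of
    the letters of the middle factor matters. *)

Set Implicit Arguments.
Unset Strict Implicit.
Unset Printing Implicit Defensive.

(* [goleft a b] tells whether inserting [a] at a node labelled [b] goes left. *)
Fixpoint insert (goleft : rel letter) (a : letter) (t : btree) : btree :=
  match t with
  | Empty => Node Empty a Empty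
  | Node l b r =>
      if goleft a b then Node (insert goleft a l) b r
      else Node l b (insert goleft a r)
  end.

(* Looks for [a] only along its insertion path, so that no search tree
   invariant has to be carried around. *)
Fixpoint on_path (goleft : rel letter) (a : letter) (t : btree) : bool :=
  match t with
  | Empty => false
  | Node l b r =>
      (a == b) || (if goleft a b then on_path goleft a l else on_path goleft a r)
  end.

(** Of two distinct letters, at least one labels a node at which their searches part. Which one
    depends on [goleft], hence the disjunction. *)
Definition self_separating (goleft : rel letter) : Prop :=
  forall a b, a != b ->
    (goleft a a != goleft b a) || (goleft a b != goleft b b).

Lemma on_path_insert_same goleft a t : on_path goleft a (insert goleft a t).
Proof.
elim: t => [|l IHl b r IHr] /=; first by rewrite eqxx.
by case: ifP => /= ->; rewrite ?IHl ?IHr orbT.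
Qed.

Lemma on_path_insert goleft a b t :
  on_path goleft a t -> on_path goleft a (insert goleft b t).
Proof.
elim: t => [//|l IHl c r IHr] /=; case: eqP => [->|_] /=.
  by case: ifP => /= _; rewrite eqxx.
case: (goleft b c) => /=; case: ifP => _ found; rewrite ?IHl ?IHr ?found ?orbT //.
Qed.

Lemma on_path_foldr goleft a t s :
  on_path goleft a t -> on_path goleft a (foldr (insert goleft) t s).
Proof. by move=> found; elim: s => //= b s; apply: on_path_insert. Qed.

Lemma on_path_foldr_mem goleft a t s :
  a \in s -> on_path goleft a (foldr (insert goleft) t s).
Proof.
elim: s => //= b s IHs; rewrite inE => /predU1P[<-|/IHs].
  exact: on_path_insert_same.
exact: on_path_insert.
Qed.

(** Both searches follow the same path until they part, at the latest at the node labelled [a]; from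
    there on they change disjoint subtrees. *)
Lemma insert_comm_separated goleft a b t :
  goleft a a != goleft b a -> on_path goleft a t ->
  insert goleft a (insert goleft b t) = insert goleft b (insert goleft a t).
Proof.
move=> sep; elim: t => [//|l IHl c r IHr] /=.
case: eqP => [<- _|_] /=.
  by move: sep; case ea: (goleft a a); case eb: (goleft b a) => //= _;
    rewrite ea eb.
by case ea: (goleft a c); case eb: (goleft b c) => //= found;
  rewrite ea eb // ?IHl ?IHr.
Qed.

Lemma insert_comm goleft a b t :
  self_separating goleft -> on_path goleft a t -> on_path goleft b t ->
  insert goleft a (insert goleft b t) = insert goleft b (insert goleft a t).
Proof.
move=> sep; have [-> //|/sep/orP[sep_a|sep_b] found_a found_b] := eqVneq a b.
  exact: insert_comm_separated.
by apply/esym/insert_comm_separated; rewrite // eq_sym.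
Qed.

Lemma foldr_insert_rcons goleft a t s :
  self_separating goleft -> all (on_path goleft ^~ t) (a :: s) ->
  foldr (insert goleft) t (rcons s a) = foldr (insert goleft) t (a :: s).
Proof.
move=> sep; elim: s => //= b s IHs /and3P[found_a found_b found_s].
by rewrite IHs /= ?found_a // insert_comm //; apply: on_path_foldr.
Qed.

Lemma foldr_insert_perm goleft t u v :
  self_separating goleft -> perm_eq u v -> all (on_path goleft ^~ t) u ->
  foldr (insert goleft) t u = foldr (insert goleft) t v.
Proof.
move=> sep; elim: u v => [|a u IHu] v.
  by rewrite perm_sym => /perm_nilP->.
move=> perm_uv found; have: a \in v by rewrite -(perm_mem perm_uv) mem_head.
move=> /path.splitPr v_split; case: v_split perm_uv => v1 v2.
rewrite perm_sym -[a :: v2]cat1s perm_catCA /= perm_cons perm_sym => perm_uv.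
have found_v : all (on_path goleft ^~ t) (a :: v1 ++ v2).
  by move: found => /=; rewrite (perm_all _ perm_uv).
have /andP[found_a found_u] := found; rewrite /= (IHu _ perm_uv found_u).
(* The letters of [v2] are inserted first; over the resulting tree, [a] commutes past all of
   [v1]. *)
rewrite -cat_rcons !foldr_cat foldr_insert_rcons //.
move: found_v => /=; rewrite all_cat => /and3P[_ found1 _].
rewrite on_path_foldr //=; apply: sub_all found1 => b; exact: on_path_foldr.
Qed.

Lemma foldr_insert_middle goleft t s u v w :
  self_separating goleft -> perm_eq u v -> {subset u <= w} ->
  foldr (insert goleft) t (s ++ u ++ w) = foldr (insert goleft) t (s ++ v ++ w).
Proof.
move=> sep perm_uv sub_uw; rewrite !foldr_cat; congr foldr.
by apply: foldr_insert_perm => //; apply/allP => a /sub_uw/on_path_foldr_mem.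
Qed.

Definition goleft_le : rel letter := fun a b => val a <= val b.
Definition goleft_lt : rel letter := fun a b => val a < val b.

(** The smaller of the two letters separates: it goes left at its own node, the larger one right. *)
Lemma goleft_le_self_separating : self_separating goleft_le.
Proof.
move=> a b; rewrite -(inj_eq val_inj) /goleft_le !leqnn.
by case: ltngtP.
Qed.

(** Here the larger letter separates, since it goes right at its own node. *)
Lemma goleft_lt_self_separating : self_separating goleft_lt.
Proof.
move=> a b; rewrite -(inj_eq val_inj) /goleft_lt !ltnn.
by case: ltngtP.
Qed.

Lemma rinsertE a t : rinsert a t = insert goleft_le a t.
Proof. by elim: t => //= l -> b r ->. Qed.

Lemma linsertE a t : linsert a t = insert goleft_lt a t.
Proof.
by elim: t => //= l -> b r ->; rewrite /goleft_lt [val a < _]ltnNge if_neg.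
Qed.

Lemma rtreeE w : rtree w = foldr (insert goleft_le) Empty w.
Proof. by elim: w => //= a w <-; rewrite -rinsertE. Qed.

Lemma ltreeE w : ltree w = foldr (insert goleft_lt) Empty (rev w).
Proof.
by elim/last_ind: w => //= w a IHw;
  rewrite rev_rcons /= -IHw -linsertE /ltree foldl_rcons.
Qed.

Lemma rtree_middle s u v w :
  perm_eq u v -> {subset u <= w} -> rtree (s ++ u ++ w) = rtree (s ++ v ++ w).
Proof.
rewrite !rtreeE; exact: foldr_insert_middle goleft_le_self_separating.
Qed.

(** Reversal makes the prefix [s] the part that is inserted first, so it is [s] that must contain
    the letters of [u]. *)
Lemma ltree_middle s u v w :
  perm_eq u v -> {subset u <= s} -> ltree (s ++ u ++ w) = ltree (s ++ v ++ w).
Proof.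
move=> perm_uv sub_us; rewrite !ltreeE !rev_cat -!catA.
apply: foldr_insert_middle goleft_lt_self_separating _ _.
  by rewrite perm_rev perm_sym perm_rev perm_sym.
by move=> a; rewrite !mem_rev => /sub_us.
Qed.

Theorem theorem6 (x y : word) :
  baxt_equiv (x ++ y ++ x ++ y ++ x ++ y) (x ++ y ++ y ++ x ++ x ++ y).
Proof.
have perm_m : perm_eq (x ++ y) (y ++ x) by rewrite perm_catC.
(* The middle factor [x ++ y] coincides with both outer factors, so the inclusion of letters is the
   identity. *)
have := @ltree_middle (x ++ y) _ _ (x ++ y) perm_m (fun a => id).
have := @rtree_middle (x ++ y) _ _ (x ++ y) perm_m (fun a => id).
by rewrite -!catA => eq_r eq_l; split.
Qed.
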